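(* Let $p$ and $q$ be distinct odd primes with $p>q$, and let $G$ be a finite group. \begin{itemize} \item If $(G, C_{2pq})$ is admissible, then so are $(G, C_p\times D_q)$, $(G, C_q\times D_p)$ and $(G, D_{pq})$. \item If either $(G, C_p\times D_q)$ or $(G, C_q\times D_p)$ is admissible, then so is $(G, D_{pq})$. \end{itemize}
   Context: $C_m$ denotes the cyclic group of order $m$ and $D_m$ denotes the dihedral group of order $2m$. For a finite group $N$, let $\mathrm{Perm}(N)$ be the symmetric group on the set $N$, and let $\lambda:N\to\mathrm{Perm}(N)$ be left translation, $\lambda(\eta)(\mu)=\eta\mu$. The holomorph $\mathrm{Hol}(N)$ is the normaliser of $\lambda(N)$ in $\mathrm{Perm}(N)$; it is isomorphic to $N\rtimes\mathrm{Aut}(N)$, with $(\eta,\alpha)\in N\rtimes\mathrm{Aut}(N)$ acting on $N$ by $(\eta,\alpha)\cdot\mu=\eta\,\alpha(\mu)$. A subgroup of $\mathrm{Hol}(N)$ is called transitive if it acts transitively on the set $N$. For a finite group $G$ and a group $N$ of order $2pq$, the pair $(G,N)$ is admissible if $G$ is isomorphic to a transitive subgroup of $\mathrm{Hol}(N)$. *)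

(* Defs.v *)
From mathcomp Require Import all_boot all_fingroup all_algebra all_solvable.

Set Implicit Arguments.
Unset Strict Implicit.
Unset Printing Implicit Defensive.

Local Open Scope group_scope.

Definition left_translation (N : finGroupType) (x : N) : {perm N} :=
  perm (@mulgI N x).

(* Permutations compose left to right in {perm N}, so left_translation is an  *)
(* anti-morphism here. The image, its normaliser and the subgroups of the     *)
(* latter are nevertheless the same sets of permutations for either           *)
(* composition order, and inversion identifies the two group structures on    *)
(* each such subgroup, so admissibility does not depend on the convention.    *)
Definition holomorph (N : finGroupType) : {group {perm N}} :=
  'N([set left_translation x | x in [set: N]])%G.

Definition admissible (gT : finGroupType) (G : {group gT}) (N : finGroupType) :
    Prop :=
  exists H : {group {perm N}},
    [/\ H \subset holomorph N, [transitive H, on [set: N] | 'P]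
      & G \isog H].

(* Main.v *)
Require Import Defs.
From mathcomp Require Import all_boot all_fingroup all_algebra all_solvable.

Set Implicit Arguments.
Unset Strict Implicit.
Unset Printing Implicit Defensive.
Import GRing.Theory.
Local Open Scope group_scope.

(** The four groups of order 2pq in the theorem are twists of one another.  Put
    n = pq.  Each is generated by an element r of odd order n and an involution
    t with r ^ t = r ^+ s, where the sign s satisfies s * s = 1 modulo n:
    s = 1 for the cyclic group, s = -1 for the dihedral group 'D_2n, and the two
    mixed signs (1 modulo one prime, -1 modulo the other) for the two direct
    products.  Writing elements as r ^+ x * t ^+ e identifies all of them, as
    sets, with 'Z_n * bool, and only the multiplication depends on s.

    In these coordinates an automorphism is a map (x, e) |-> (m x + e u, e) for
    which the image (u, 1) of t is still an involution, that is (1 + s) u = 0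
    (lemma twisted_automorphism).  Left translations are also affine in x, so
    the holomorph consists of affine maps, and the single place where s matters
    is the constraint (1 + s) u = 0.  For s = 1 it says u = 0, as n is odd; for
    s = -1 it is void.  Hence, as permutation groups on the common set
    'Z_n * bool, the holomorph of the cyclic group lies inside the holomorphs of
    both direct products, and these lie inside the holomorph of the dihedral
    group (lemma twisted_admissible).  A transitive subgroup of a smaller
    holomorph is literally a transitive subgroup of a larger one. *)

(** * The holomorph as translations times automorphisms *)

Lemma holomorph_morph (N : finGroupType) (s : {perm N}) :
  s \in holomorph N -> {morph (fun x => (s 1)^-1 * s x) : x y / x * y}.
Proof.
move=> /normP hs x y.
(* Conjugating the translation by x gives the translation by some z, hence *)
(* s (x * u) = z * s u for all u, and u = 1 determines z. *)
have : left_translation x ^ s \in [set left_translation x | x in [set: N]].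
  by rewrite -hs memJ_conjg imset_f ?inE.
case/imsetP=> z _ xs.
have sE u : s (x * u) = z * s u.
  have := congr1 (fun t : {perm N} => t (s u)) xs.
  by rewrite permJ !permE.
have := sE 1; rewrite mulg1 sE => ->.
by rewrite -!mulgA mulKVg.
Qed.

(** With holomorph_morph, this identifies the holomorph with the set of maps
    x |-> c * a x, where a is an automorphism. *)
Lemma mem_holomorph (N : finGroupType) (s : {perm N}) (c : N) (a : N -> N) :
  {morph a : x y / x * y} -> (forall x, s x = c * a x) -> s \in holomorph N.
Proof.
move=> aM sE; rewrite inE; apply/subsetP=> _ /imsetP[_ /imsetP[x _ ->] ->].
apply/imsetP; exists (c * a x * c^-1) => //; apply/permP=> y.
rewrite -[y](permKV s) permJ !permE !sE aM.
by rewrite -!mulgA mulKg.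
Qed.

(** When h carries the holomorph of N into that of M, conjugation by h embeds
    any transitive subgroup of the former as a transitive subgroup of the
    latter. *)
Lemma admissible_transport (N M : finGroupType) (h : N -> M) :
    bijective h ->
    (forall (s : {perm N}) (t : {perm M}), s \in holomorph N ->
       (forall x, t (h x) = h (s x)) -> t \in holomorph M) ->
  forall (gT : finGroupType) (G : {group gT}), admissible G N -> admissible G M.
Proof.
move=> [k hK kK] hol gT G [H [sH trH isoGH]].
have tr_inj (s : {perm N}) : injective (fun y => h (s (k y))).
  by move=> x y /(can_inj hK)/perm_inj/(can_inj kK).
pose tr s := perm (@tr_inj s).
have trE s x : tr s (h x) = h (s x) by rewrite permE hK.
have trM : {in H &, {morph tr : s t / s * t}}.
  by move=> s t _ _; apply/permP=> y; rewrite -[y]kK permM !trE permM.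
have injtr : 'injm (Morphism trM).
  apply/injmP=> s t _ _ /permP eq_st; apply/permP=> x.
  by apply: (can_inj hK); rewrite -!trE eq_st.
exists (Morphism trM @* H)%G; split=> /=.
- apply/subsetP=> _ /morphimP[s _ Hs ->] /=.
  by apply: (hol s) => //; apply: (subsetP sH).
- apply/imsetP; exists (h 1) => //; apply/setP=> y; rewrite inE; symmetry.
  have: k y \in orbit 'P H 1 by rewrite (atransP trH) ?inE.
  case/orbitP=> s Hs /= sE; apply/orbitP; exists (tr s).
    exact: (mem_morphim (Morphism trM)).
  by rewrite -[RHS]kK -sE; apply: trE.
- by apply: isog_trans isoGH _; apply: (sub_isog (subxx _) injtr).
Qed.

(** * Coordinates on a cyclic group extended by an involution *)

(** The law of the semidirect product of 'Z_n by an involution that acts as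
    multiplication by s; the boolean is the exponent of the involution. *)
Definition twisted_mul n (s : 'Z_n) (x y : 'Z_n * bool) : 'Z_n * bool :=
  ((x.1 + (if x.2 then s * y.1 else y.1))%R, x.2 (+) y.2).

Definition twisted_coords (N : finGroupType) n (s : 'Z_n) (f : 'Z_n * bool -> N)
    : Prop :=
  bijective f /\ forall x y, f x * f y = f (twisted_mul s x y).

Definition twisted_cyclic n s (N : finGroupType) : Prop :=
  exists r t : N, [/\ #[r] = n, #[t] = 2, r ^ t = r ^+ s & #|N| = (2 * n)%N].

(** Since n is odd, t is not a power of r, so the elements r ^+ x * t ^+ e are
    pairwise distinct, and counting shows that they exhaust N. *)
Lemma twisted_cyclic_coords n s N : 1 < n -> odd n -> twisted_cyclic n s N ->
  exists f : 'Z_n * bool -> N, twisted_coords (s%:R)%R f.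
Proof.
move=> n_gt1 n_odd [r [t [or ot rt cN]]].
have tt : t * t = 1 by rewrite -(expg_order t) ot.
pose f (x : 'Z_n * bool) := r ^+ x.1 * t ^+ x.2.
have rnat (k : nat) : r ^+ (k%:R : 'Z_n)%R = r ^+ k.
  by rewrite val_Zp_nat // -or expg_mod_order.
have rD (x y : 'Z_n) : r ^+ (x + y)%R = r ^+ x * r ^+ y.
  by rewrite -[x]natr_Zp -[y]natr_Zp -natrD !rnat expgD.
have rs (y : 'Z_n) : r ^+ (s%:R * y)%R = (r ^+ y) ^ t.
  by rewrite -[y]natr_Zp -natrM !rnat conjXg rt expgM.
exists f; split.
  have card_eq : #|{: 'Z_n * bool}| >= #|N|.
    by rewrite card_prod card_bool card_ord Zp_cast // cN mulnC.
  apply: inj_card_bij card_eq => -[x e] [y e'].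
  have tNr : t \notin <[r]>.
    by apply/negP=> /order_dvdG; rewrite -orderE or ot dvdn2 n_odd.
  have inj_r (u v : 'Z_n) : r ^+ u = r ^+ v -> u = v.
    have ltu (w : 'Z_n) : w < n by rewrite (leq_trans (ltn_ord w)) ?Zp_cast.
    by move/eqP; rewrite eq_expg_mod_order or !modn_small // => /eqP/val_inj.
  rewrite /f; case: e e' => [] [] /=; rewrite ?expg1 ?expg0 ?mulg1.
  - by move/mulIg/inj_r->.
  - move=> eq_rt; case/negP: tNr; rewrite -(groupMl _ (mem_cycle r x)).
    by rewrite eq_rt mem_cycle.
  - move=> eq_rt; case/negP: tNr; rewrite -(groupMl _ (mem_cycle r y)).
    by rewrite -eq_rt mem_cycle.
  - by move/inj_r->.
move=> [x e] [y e']; rewrite /f /twisted_mul /=.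
have tV : t^-1 = t by apply/eqP; rewrite eq_invg_mul tt.
rewrite rD -!mulgA; congr (_ * _).
case: e e' => [] [] /=; rewrite ?expg1 ?expg0 ?mulg1 ?mul1g //.
  by rewrite rs conjgE tV.
by rewrite rs conjgE tV -!mulgA tt mulg1.
Qed.

Section TwistedCoords.

Variables (n : nat) (s : 'Z_n) (N : finGroupType) (f : 'Z_n * bool -> N).
Hypotheses (n_gt1 : 1 < n) (n_odd : odd n) (fP : twisted_coords s f).

(** For odd n, (n + 1) / 2 is an inverse of 2 modulo n. *)
Lemma half_Zp : exists h : 'Z_n, forall x : 'Z_n, (h * x + h * x)%R = x.
Proof.
exists (uphalf n)%:R%R => x; rewrite -mulrDl -natrD addnn.
have -> : (uphalf n).*2 = n.+1 by rewrite uphalfE even_halfK //= n_odd.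
by rewrite -addn1 natrD pchar_Zp // add0r mul1r.
Qed.

Lemma double_Zp_eq0 (x : 'Z_n) : (x + x = 0 -> x = 0)%R.
Proof.
by case: half_Zp => h hK xx; rewrite -(hK x) -mulrDr xx mulr0.
Qed.

Lemma twisted_coords1 : f (0%R, false) = 1.
Proof.
by apply: (mulgI (f (0%R, false))); rewrite fP.2 mulg1 /twisted_mul /= addr0.
Qed.

(** Compare the two ways of associating t * t * r. *)
Lemma twist_sqr : (s * s = 1)%R.
Proof.
have := mulgA (f (0%R, true)) (f (0%R, true)) (f (1%R, false)).
rewrite !fP.2 => /(bij_inj fP.1); rewrite /twisted_mul /=.
by rewrite !(mulr0, mulr1, add0r) => /(congr1 fst).
Qed.

(** Rotations, the elements with boolean coordinate false, are squares because
    n is odd, so a preserves them and acts on them additively, hence by a scalar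
    m.  The image of t is not a rotation, for a rotation squaring to 1 is
    trivial; so it is (u, true), and its square ((1 + s) u, false) is
    trivial. *)
Lemma twisted_automorphism (a : N -> N) :
    injective a -> {morph a : x y / x * y} ->
  exists m u : 'Z_n, ((1 + s) * u = 0)%R /\
    forall x e, a (f (x, e)) = f ((m * x + (if e then u else 0))%R, e).
Proof.
move=> a_inj aM; have [[k fK kK] fM] := fP.
pose c X := k (a (f X)).
have cE X : f (c X) = a (f X) by rewrite kK.
have cM X Y : c (twisted_mul s X Y) = twisted_mul s (c X) (c Y).
  by apply: (can_inj fK); rewrite -fM !cE -aM fM.
have c0 : c (0%R, false) = (0%R, false).
  apply: (can_inj fK); rewrite cE twisted_coords1.
  by apply: (mulgI (a 1)); rewrite -aM !mulg1.
have rot x : (c (x, false)).2 = false.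
  have [h hK] := half_Zp.
  rewrite -(hK x) -[(_ + _, _)%R]/(twisted_mul s (_, false) (_, false)).
  by rewrite cM /= addbb.
pose m := (c (1%R, false)).1.
have cx x : c (x, false) = ((m * x)%R, false).
  rewrite [LHS]surjective_pairing rot -[x]natr_Zp; congr (_, _).
  elim: (x : nat) => [|j IHj]; first by rewrite mulr0 c0.
  have -> : (j.+1%:R%R, false) = twisted_mul s (j%:R%R, false) (1%R, false).
    by rewrite /twisted_mul /= -natr1.
  by rewrite cM /= rot IHj -natr1 mulrDr mulr1.
case tE: (c (0%R, true)) => [u e].
have tt := cM (0%R, true) (0%R, true).
move: tt; rewrite /twisted_mul /= mulr0 addr0 c0 tE /= addbb.
case: e tE => tE /(congr1 fst)/= uu; last first.
  have u0 : u = 0%R by apply: double_Zp_eq0.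
  have/(can_inj fK)/eqP: f (0%R, true) = f (0%R, false).
    by apply: a_inj; rewrite -!cE tE c0 u0.
  by rewrite xpair_eqE andbF.
exists m, u; split=> [|x e]; first by rewrite mulrDl mul1r -uu.
rewrite -cE; congr f; case: e; last by rewrite cx addr0.
have -> : (x, true) = twisted_mul s (x, false) (0%R, true).
  by rewrite /twisted_mul /= addr0.
by rewrite cM cx tE.
Qed.

End TwistedCoords.

(** * Comparing holomorphs for two signs *)

(** Left translation by (b, e) composed with an automorphism of scalar m and
    offset u sends (x, d) to (b + s^e (m x + d u), e + d). Replacing s by s' in
    this formula amounts to multiplying m and u by w = (s' s)^e, as s' s' = 1,
    so the same map is a translation composed with an automorphism for the sign
    s' as soon as (1 + s') (w u) = 0, which follows from (1 + s) u = 0 under the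
    hypothesis that compares the two signs. *)
Lemma twisted_admissible n (s s' : nat) (N M : finGroupType) :
    1 < n -> odd n -> twisted_cyclic n s N -> twisted_cyclic n s' M ->
    (forall u : 'Z_n, (1 + s%:R) * u = 0 -> (1 + s'%:R) * u = 0)%R ->
  forall (gT : finGroupType) (G : {group gT}), admissible G N -> admissible G M.
Proof.
move=> n_gt1 n_odd /(twisted_cyclic_coords n_gt1 n_odd)[f fP].
move=> /(twisted_cyclic_coords n_gt1 n_odd)[g gP] le_ss' gT G.
have [[k fK kK] fM] := fP; have [[l gK lK] gM] := gP.
apply: (@admissible_transport _ _ (g \o k)).
  by exists (f \o l) => x /=; rewrite ?gK ?kK ?fK ?lK.
move=> phi psi hol_phi psiE; move: hol_phi => /holomorph_morph aM.
have a_inj : injective (fun x => (phi 1)^-1 * phi x).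
  by move=> x y /mulgI/perm_inj.
have [m [u [su aE]]] := twisted_automorphism n_gt1 n_odd fP a_inj aM.
case cE: (k (phi 1)) => [b e].
have phiE x d : phi (f (x, d)) =
    f (twisted_mul s%:R%R (b, e) ((m * x + (if d then u else 0))%R, d)).
  by rewrite -fM -aE -cE kK mulKVg.
pose w : 'Z_n := (if e then s'%:R * s%:R else 1)%R.
pose a' y := let: (x, d) := l y in
  g ((w * m * x + (if d then w * u else 0))%R, d).
apply: (@mem_holomorph _ _ (g (b, e)) a') => [y z|y].
  rewrite -[y]lK -[z]lK gM /a' !gK.
  case: (l y) (l z) => [x d] [x' d'] /=.
  have s'u : (s'%:R * (w * u) = - (w * u))%R.
    apply/eqP; rewrite -addr_eq0 addrC -{1}[(w * u)%R]mul1r -mulrDl.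
    by rewrite mulrCA le_ss' ?mulr0.
  (* Multiplicativity of a' is an issue only when both arguments are *)
  (* reflections, where the two offsets cancel because s' (w u) = - (w u). *)
  rewrite gM /twisted_mul /=; congr g; congr (_, _).
  case: d d' => [] [] /=; rewrite ?addr0 ?mulrDr ?s'u.
  - by rewrite -addrA [(w * u + _)%R]addrC -addrA addNr addr0 mulrCA.
  - by rewrite mulrCA addrAC.
  - by rewrite addrA.
  - by [].
rewrite -[y]lK /a' gK; case: (l y) => [x d].
have := psiE (f (x, d)); rewrite /= fK => ->.
rewrite phiE fK gM; congr g; rewrite /twisted_mul /= /w.
congr ((_ + _)%R, _); case: e {cE phiE a'} w => //= _; last first.
  by rewrite !mul1r.
have ss' := twist_sqr gP.
rewrite !mulrDr !mulrA ss' mul1r; congr (_ + _)%R.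
by case: d; rewrite ?mulr0 // !mulrA ss' mul1r.
Qed.

(** * The signs of the cyclic, dihedral and mixed groups *)

Lemma expg_pair (A B : finGroupType) (x : A) (y : B) k :
  (x, y) ^+ k = (x ^+ k, y ^+ k).
Proof. by elim: k => // k IHk; rewrite !expgS IHk. Qed.

Lemma order_pair (A B : finGroupType) (x : A) (y : B) :
  coprime #[x] #[y] -> #[(x, y)] = (#[x] * #[y])%N.
Proof.
move=> co_xy; have ordE k : (#[(x, y)] %| k) = (#[x] * #[y] %| k).
  by rewrite Gauss_dvd // !order_dvdn expg_pair -xpair_eqE.
by apply/eqP; rewrite eqn_dvd ordE dvdnn -ordE dvdnn.
Qed.

(** The involution acts trivially on the new cyclic factor, so the Chinese
    remainder theorem gives the sign that is 1 modulo a and s modulo b. *)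
Lemma twisted_cyclic_prod (C D : finGroupType) (z : C) a b s :
    #[z] = a -> #|C| = a -> coprime a b ->
    twisted_cyclic b s D ->
  exists s', twisted_cyclic (a * b) s' (C * D)%type.
Proof.
move=> oz cC co_ab [r [t [or ot rt cD]]].
exists (chinese a b 1 s), (z, r), (1, t); split.
- by rewrite order_pair oz or.
- by rewrite order_pair order1 ?ot ?coprime1n.
- rewrite expg_pair.
  have -> : z ^+ chinese a b 1 s = z ^+ 1.
    by apply/eqP; rewrite eq_expg_mod_order oz chinese_modl.
  have -> : r ^+ chinese a b 1 s = r ^+ s.
    by apply/eqP; rewrite eq_expg_mod_order or chinese_modr.
  rewrite -rt expg1; congr (_, _).
  by rewrite -[RHS](conjg1 z).
- by rewrite card_prod cC cD mulnCA.
Qed.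

(** The presentation only bounds the orders of the rotation and the reflection
    from above; the order of the whole group makes both bounds equalities. *)
Lemma twisted_cyclic_dihedral n :
  1 < n -> twisted_cyclic n n.-1 ('D_(2 * n))%type.
Proof.
move=> n_gt1.
rewrite mul2n.
have [cD] := isoGrpP _ (Grp_dihedral n_gt1) (isog_refl [set: 'D_n.*2]%G).
move=> /existsP[[x y]] /= /eqP[defD xn y2 xy].
have {}defD : <[x]> * <[y]> = [set: 'D_n.*2].
  by rewrite -norm_joinEr // norms_cycle xy groupV cycle_id.
have leox : #[x] <= n by rewrite dvdn_leq ?(ltnW n_gt1) // order_dvdn xn.
have leoy : #[y] <= 2 by rewrite dvdn_leq // order_dvdn y2.
have geoxy : n.*2 <= #[x] * #[y].
  rewrite !orderE mul_cardG defD card_dihedral //.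
  by rewrite leq_pmulr // (cardG_gt0 (<[x]> :&: <[y]>)).
have oy : #[y] = 2.
  apply/eqP; rewrite eqn_leq leoy -(leq_pmul2l (ltnW n_gt1)) muln2.
  by rewrite (leq_trans geoxy) ?leq_mul2r ?leox ?orbT.
have ox : #[x] = n.
  apply/eqP; rewrite eqn_leq leox -(@leq_pmul2l 2) // -{2}oy mulnC.
  by rewrite [(#[y] * _)%N]mulnC muln2.
exists x, y; split=> //; last by rewrite -cardsT card_dihedral // mul2n.
by rewrite xy; apply/eqP; rewrite eq_invg_mul -expgS prednK ?xn // ltnW.
Qed.

Lemma twisted_cyclic_cyclic n : 1 < n -> twisted_cyclic n 1 'Z_(2 * n).
Proof.
move=> n_gt1.
have m_gt : 1 < 2 * n by rewrite (leq_trans n_gt1) ?leq_pmull.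
have o1 : #[Zp1 : 'Z_(2 * n)] = (2 * n)%N by rewrite order_Zp1 Zp_cast.
exists ((Zp1 : 'Z_(2 * n)) ^+ 2), ((Zp1 : 'Z_(2 * n)) ^+ n); split.
- by rewrite orderXdiv o1 ?dvdn_mulr // mulKn.
- by rewrite orderXdiv o1 ?dvdn_mull // mulnK // ltnW.
- by rewrite expg1 conjgE -expgD addnC expgD mulKg.
- by rewrite card_ord Zp_cast.
Qed.

Local Close Scope group_scope.

(* C_m is the additive group 'Z_m; in 'D_m the index is the order, so the
   dihedral group of order 2m is 'D_(2 * m). *)
Theorem proposition5p1 (p q : nat) (p_pr : prime p) (q_pr : prime q)
    (p_odd : odd p) (q_odd : odd q) (q_lt_p : q < p)
    (gT : finGroupType) (G : {group gT}) :
  (admissible G 'Z_(2 * p * q) ->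
     [/\ admissible G ('Z_p * 'D_(2 * q)%N)%type,
         admissible G ('Z_q * 'D_(2 * p)%N)%type
       & admissible G 'D_(2 * (p * q))])
  /\
  (admissible G ('Z_p * 'D_(2 * q)%N)%type \/
   admissible G ('Z_q * 'D_(2 * p)%N)%type ->
     admissible G 'D_(2 * (p * q))).
Proof.
have [p_gt1 q_gt1] := (prime_gt1 p_pr, prime_gt1 q_pr).
pose n := (p * q)%N.
have n_odd : odd n by rewrite oddM p_odd q_odd.
have n_gt1 : 1 < n by rewrite (leq_trans p_gt1) // leq_pmulr ?prime_gt0.
have co_pq : coprime p q.
  by rewrite prime_coprime // dvdn_prime2 // gtn_eqF.
have cycP := twisted_cyclic_cyclic n_gt1.
have dihP := twisted_cyclic_dihedral n_gt1.
have mixP a b : 1 < a -> 1 < b -> coprime a b ->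
    exists s, twisted_cyclic (a * b) s ('Z_a * 'D_(2 * b)%N)%type.
  move=> a_gt1 b_gt1 co_ab.
  apply: (@twisted_cyclic_prod _ _ (Zp1 : 'Z_a) _ _ _ _ _ co_ab
                               (twisted_cyclic_dihedral b_gt1)).
  - by rewrite order_Zp1 Zp_cast.
  - by rewrite card_ord Zp_cast.
have [s1 mix1P] := mixP _ _ p_gt1 q_gt1 co_pq.
have [s2] := mixP _ _ q_gt1 p_gt1 (etrans (coprime_sym q p) co_pq).
rewrite mulnC -/n => mix2P.
(* The cyclic group has the strongest constraint; the dihedral group, whose *)
(* sign n.-1 stands for -1, has none. *)
have cyc_le s (u : 'Z_n) : ((1 + 1%:R) * u = 0 -> (1 + s%:R) * u = 0)%R.
  by rewrite mulrDl mul1r => /(double_Zp_eq0 n_gt1 n_odd)->; rewrite mulr0.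
have dih_top (u : 'Z_n) : ((1 + n.-1%:R) * u = 0)%R.
  by rewrite nat1r prednK ?(ltnW n_gt1) // pchar_Zp // mul0r.
have adm := twisted_admissible n_gt1 n_odd.
rewrite -mulnA; split=> [admC | [] admX].
- split; [apply: (adm _ _ _ _ cycP mix1P _ _ _ admC)
         |apply: (adm _ _ _ _ cycP mix2P _ _ _ admC)
         |apply: (adm _ _ _ _ cycP dihP _ _ _ admC)] => u; exact: cyc_le.
- by apply: (adm _ _ _ _ mix1P dihP _ _ _ admX) => u _; apply: dih_top.
- by apply: (adm _ _ _ _ mix2P dihP _ _ _ admX) => u _; apply: dih_top.
Qed.
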